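(* Let $a<b$ be real numbers and let $f:[a,b]\to[a,b]$ be a Lipschitz and topologically transitive map with a fixed point $c\in[a,b]$. Consider $M=[a,b]$ with its usual metric $|\cdot|$ as a pointed metric space with base point $c$. Then the Lipschitz operator $\widehat{f}:\mathcal{F}(M)\to\mathcal{F}(M)$ is weakly mixing. If moreover $f$ admits at least two fixed points, then $\widehat{f}$ is mixing.
   Context: For a metric space $(M,d)$ with a distinguished base point (here $c$), $\mathrm{Lip}_0(M)$ is the real Banach space of Lipschitz functions $M\to\mathbb{R}$ vanishing at the base point, with norm the best Lipschitz constant. For $x\in M$, $\delta(x)\in \mathrm{Lip}_0(M)^*$ is the evaluation $\langle \varphi,\delta(x)\rangle=\varphi(x)$. The Lipschitz-free space is $\mathcal{F}(M)=\overline{\mathrm{span}}^{\|\cdot\|}\{\delta(x):x\in M\}\subset \mathrm{Lip}_0(M)^*$. If $f:M\to M$ is Lipschitz and fixes the base point, $\widehat{f}:\mathcal{F}(M)\to\mathcal{F}(M)$ is the unique bounded linear operator with $\widehat{f}(\delta(x))=\delta(f(x))$ for all $x\in M$. Let $F:X\to X$ be a continuous self-map of a metric space $X$ (in particular a bounded linear operator on a Banach space). $F$ is topologically transitive if for all nonempty open $U,V\subset X$ there is $n\in\mathbb{N}_0=\{0,1,2,\dots\}$ with $F^n(U)\cap V\neq\emptyset$; $F$ is mixing if for all nonempty open $U,V$ there is $N\in\mathbb{N}_0$ with $F^n(U)\cap V\ne\emptyset$ for every $n\ge N$; $F$ is weakly mixing if $F\times F$ is topologically transitive on $X\times X$. 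*)

(* Defs.v *)
From HB Require Import structures.
From mathcomp Require Import all_boot all_order all_algebra.
From mathcomp Require Import all_classical all_reals.
From mathcomp Require Import topology normedtype.

Set Implicit Arguments.
Unset Strict Implicit.
Unset Printing Implicit Defensive.

Import Order.TTheory GRing.Theory Num.Theory.
Import numFieldNormedType.Exports.

Local Open Scope classical_set_scope.
Local Open Scope ring_scope.

Section dynamics.
Context {X : topologicalType}.
Implicit Type F : X -> X.

Definition topologically_transitive F :=
  forall U V : set X, open U -> open V -> U !=set0 -> V !=set0 ->
  exists n : nat, (iter n F @` U) `&` V !=set0.

Definition mixing F :=
  forall U V : set X, open U -> open V -> U !=set0 -> V !=set0 ->
  exists N : nat, forall n : nat, (N <= n)%N -> (iter n F @` U) `&` V !=set0.

End dynamics.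

Definition weakly_mixing {X : topologicalType} (F : X -> X) :=
  topologically_transitive (fun p : X * X => (F p.1, F p.2)).

(* The library puts on [set_type A] the topology and the balls induced by
   [set_val]; this adds the corresponding distance. *)
Section subset_metric.
Context {R : realType} (A : set R).

Let dist (x y : A) : R := `|set_val x - set_val y|.

Let dist_ge0 x y : 0 <= dist x y. Proof. exact: normr_ge0. Qed.

Let dist_positivity x y : dist x y = 0 -> x = y.
Proof. by move/normr0_eq0/eqP; rewrite subr_eq0 => /eqP /val_inj. Qed.

Let ballEdist (x : A) d : ball x d = [set y | dist x y < d].
Proof. by []. Qed.

HB.instance Definition _ := @PseudoMetric_isMetric.Build R (set_type A)
  dist dist_ge0 dist_positivity ballEdist.

End subset_metric.

Definition lipschitz_map {R : realType} {M N : metricType R} (f : M -> N) :=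
  exists k : R, forall x y, mdist (f x) (f y) <= k * mdist x y.

Definition bounded_operator {R : realType} {V W : normedModType R}
    (T : V -> W) :=
  exists C : R, forall v, `|T v| <= C * `|v|.

Section lip0.
Context {R : realType} {M : metricType R}.

Definition lip_consts (phi : M -> R) : set R :=
  [set k | 0 <= k /\ forall x y, `|phi x - phi y| <= k * mdist x y].

Variable c : M.

Definition lip0_pred : {pred M -> R} :=
  mem [set phi | lip_consts phi !=set0 /\ phi c = 0].

Lemma lip0_submod : submod_closed lip0_pred.
Proof.
split; first by apply/mem_set; split => //; exists 0; split => // x y;
  rewrite subrr normr0 mul0r.
move=> a f g /set_mem[[k [k0 fk]] fc] /set_mem[[l [l0 gl]] gc].
apply/mem_set; split; last by rewrite !fctE /= fc gc addr0 scaler0.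
exists (`|a| * k + l); split; first by rewrite addr_ge0// mulr_ge0.
move=> x y.
have -> : (a *: f + g) x - (a *: f + g) y = a * (f x - f y) + (g x - g y).
  by rewrite !fctE /= /GRing.scale /= opprD addrACA mulrBr.
rewrite (le_trans (ler_normD _ _))// mulrDl lerD// normrM -mulrA.
by rewrite ler_wpM2l.
Qed.

HB.instance Definition _ :=
  GRing.isSubmodClosed.Build R (M -> R) lip0_pred lip0_submod.

Record lip0 := Lip0 { lip0_fun :> M -> R ; _ : lip0_fun \in lip0_pred }.

HB.instance Definition _ := [isSub for lip0_fun].
HB.instance Definition _ := [Choice of lip0 by <:].
HB.instance Definition _ := [SubChoice_isSubLmodule of lip0 by <:].

Implicit Types phi psi : lip0.

(* The best Lipschitz constant; the infimum is attained, see [lip_normP]. *)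
Definition lip_norm (phi : lip0) : R := inf (lip_consts phi).

Lemma lip0_base (phi : lip0) : phi c = 0.
Proof. by case: phi => f /= /set_mem[]. Qed.

Lemma lip_norm_ge0 phi : 0 <= lip_norm phi.
Proof.
by apply: lb_le_inf => [|k []//]; case: phi => f /= /set_mem[].
Qed.

Lemma lip_normP (phi : lip0) x y :
  `|phi x - phi y| <= lip_norm phi * mdist x y.
Proof.
have [->|xy] := eqVneq x y; first by rewrite subrr normr0 mdistxx mulr0.
rewrite -ler_pdivrMr ?mdist_gt0//; apply: lb_le_inf => [|k [k0 kP]].
  by case: phi => f /= /set_mem[].
by rewrite ler_pdivrMr ?mdist_gt0.
Qed.

Lemma lip_norm_le (phi : lip0) k : 0 <= k ->
  (forall x y, `|phi x - phi y| <= k * mdist x y) -> lip_norm phi <= k.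
Proof. by move=> k0 kP; apply: ge_inf => //; exists 0 => l []. Qed.

Lemma lip_normD phi psi : lip_norm (phi + psi) <= lip_norm phi + lip_norm psi.
Proof.
apply: lip_norm_le => [|x y]; first by rewrite addr_ge0 ?lip_norm_ge0.
rewrite mulrDl; apply: le_trans (lerD (lip_normP phi x y) (lip_normP psi x y)).
by rewrite opprD addrACA ler_normD.
Qed.

Lemma lip_normZ_le a phi : lip_norm (a *: phi) <= `|a| * lip_norm phi.
Proof.
apply: lip_norm_le => [|x y]; first by rewrite mulr_ge0 ?lip_norm_ge0.
rewrite -mulrA.
have -> : (a *: phi) x - (a *: phi) y = a * (phi x - phi y) by rewrite mulrBr.
by rewrite normrM ler_wpM2l ?lip_normP.
Qed.

Lemma lip_normZ a phi : lip_norm (a *: phi) = `|a| * lip_norm phi.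
Proof.
apply/eqP; rewrite eq_le lip_normZ_le /=.
have [->|a0] := eqVneq a 0; first by rewrite normr0 mul0r lip_norm_ge0.
rewrite -ler_pdivlMl ?normr_gt0// -normfV -[phi in leLHS]scale1r.
by rewrite -(mulVf a0) -scalerA lip_normZ_le.
Qed.

Lemma lip_norm0_eq0 phi : lip_norm phi = 0 -> phi = 0.
Proof.
move=> phi0; apply/val_inj/funext => x.
have := lip_normP phi x c; rewrite phi0 mul0r lip0_base subr0.
by rewrite normr_le0 => /eqP.
Qed.

HB.instance Definition _ := @Lmodule_isNormed.Build R lip0
  lip_norm lip_normD lip_normZ lip_norm0_eq0.

End lip0.
Arguments lip0 {R} M c.

Section dual.
Context {R : realType} (V : normedModType R).

Definition dual_pred : {pred V -> R} :=
  mem [set u : V -> R | scalar u /\ bounded_operator u].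

Lemma dual_submod : submod_closed dual_pred.
Proof.
split.
  apply/mem_set; split => [a v w|]; first by rewrite /= mulr0 addr0.
  by exists 0 => v; rewrite normr0 mul0r.
move=> a u1 u2 /set_mem[u1l [C1 u1C]] /set_mem[u2l [C2 u2C]].
apply/mem_set; split.
  move=> b v w; rewrite !fctE /= u1l u2l.
  rewrite /GRing.scale/= !mulrDr !mulrA addrACA; congr (_ + _ + _).
  by rewrite [a * b]mulrC.
exists (`|a| * C1 + C2) => v; rewrite !fctE (le_trans (ler_normD _ _))//.
by rewrite mulrDl lerD// normrM -mulrA ler_wpM2l.
Qed.

HB.instance Definition _ :=
  GRing.isSubmodClosed.Build R (V -> R) dual_pred dual_submod.

Record dual := Dual { dual_fun :> V -> R ; _ : dual_fun \in dual_pred }.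

HB.instance Definition _ := [isSub for dual_fun].
HB.instance Definition _ := [Choice of dual by <:].
HB.instance Definition _ := [SubChoice_isSubLmodule of dual by <:].

Definition dual_norm (u : dual) : R :=
  sup [set `|u v| | v in [set v | `|v| <= 1]].

Lemma dual_scalar (u : dual) : scalar u.
Proof. by case: u => u /= /set_mem[]. Qed.

Lemma dual0 (u : dual) : u 0 = 0.
Proof.
by have := dual_scalar u (-1) 0 0; rewrite scaler0 addr0 mulN1r addNr.
Qed.

Lemma dualZ (u : dual) a v : u (a *: v) = a * u v.
Proof. by rewrite -[a *: v]addr0 (dual_scalar u) dual0 addr0. Qed.

Lemma dual_norm_has_sup (u : dual) :
  has_sup [set `|u v| | v in [set v | `|v| <= 1]].
Proof.
split; first by exists `|u 0|; exists 0 => //=; rewrite normr0.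
case: u => u /= /set_mem[_ [C uC]]; exists `|C| => _ [v /= v1 <-].
rewrite (le_trans (uC v))// -[leRHS]mulr1 (le_trans (ler_norm _))//.
by rewrite normrM normr_id ler_wpM2l.
Qed.

Lemma dual_normP (u : dual) v : `|u v| <= dual_norm u * `|v|.
Proof.
have [->|v0] := eqVneq v 0; first by rewrite dual0 !normr0 mulr0.
rewrite -ler_pdivrMr ?normr_gt0//.
apply: (ub_le_sup (dual_norm_has_sup u).2).
exists (`|v|^-1 *: v) => /=.
  by rewrite normrZ normfV normr_id mulVf// normr_eq0.
by rewrite dualZ normrM normfV normr_id mulrC.
Qed.

Lemma dual_norm_le (u : dual) C : 0 <= C ->
  (forall v, `|u v| <= C * `|v|) -> dual_norm u <= C.
Proof.
move=> C0 uC; apply: ge_sup; first exact: (dual_norm_has_sup u).1.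
by move=> _ [v /= v1 <-]; rewrite (le_trans (uC v))// ler_piMr.
Qed.

Lemma dual_norm_ge0 (u : dual) : 0 <= dual_norm u.
Proof.
apply: (le_trans (normr_ge0 (u 0))).
apply: (ub_le_sup (dual_norm_has_sup u).2).
by exists 0 => //=; rewrite normr0.
Qed.

Lemma dual_normD u1 u2 : dual_norm (u1 + u2) <= dual_norm u1 + dual_norm u2.
Proof.
apply: dual_norm_le => [|v]; first by rewrite addr_ge0 ?dual_norm_ge0.
rewrite mulrDl; apply: le_trans (lerD (dual_normP u1 v) (dual_normP u2 v)).
exact: ler_normD.
Qed.

Lemma dual_normZ_le a u : dual_norm (a *: u) <= `|a| * dual_norm u.
Proof.
apply: dual_norm_le => [|v]; first by rewrite mulr_ge0 ?dual_norm_ge0.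
by rewrite -mulrA [X in X <= _]normrM ler_wpM2l ?dual_normP.
Qed.

Lemma dual_normZ a u : dual_norm (a *: u) = `|a| * dual_norm u.
Proof.
apply/eqP; rewrite eq_le dual_normZ_le /=.
have [->|a0] := eqVneq a 0; first by rewrite normr0 mul0r dual_norm_ge0.
rewrite -ler_pdivlMl ?normr_gt0// -normfV -[u in leLHS]scale1r.
by rewrite -(mulVf a0) -scalerA dual_normZ_le.
Qed.

Lemma dual_norm0_eq0 u : dual_norm u = 0 -> u = 0.
Proof.
move=> u0; apply/val_inj/funext => v.
by have := dual_normP u v; rewrite u0 mul0r normr_le0 => /eqP.
Qed.

HB.instance Definition _ := @Lmodule_isNormed.Build R dual
  dual_norm dual_normD dual_normZ dual_norm0_eq0.

End dual.

Section span.
Context {R : realType} {V : normedModType R}.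

Definition lin_span (A : set V) : set V :=
  [set v | exists (n : nat) (a : 'I_n -> R) (w : 'I_n -> V),
    (forall i, A (w i)) /\ v = \sum_(i < n) a i *: w i].

Lemma lin_span0 A : lin_span A 0.
Proof.
exists 0%N, (fun=> 0), (fun=> 0); split; first by case.
by rewrite big_ord0.
Qed.

Lemma lin_spanP A (b : R) u v :
  lin_span A u -> lin_span A v -> lin_span A (b *: u + v).
Proof.
move=> [n [a [w [Aw ->]]]] [m [a' [w' [Aw' ->]]]].
exists (n + m)%N, (fun i : 'I_(n + m) => match fintype.split i with
                    | inl j => b * a j | inr j => a' j end),
  (fun i : 'I_(n + m) => match fintype.split i with
                    | inl j => w j | inr j => w' j end); split.
  by move=> i; case: (fintype.split i).
rewrite big_split_ord /= scaler_sumr; congr (_ + _); apply: eq_bigr => i _.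
  by rewrite (unsplitK (inl i)) scalerA.
by rewrite (unsplitK (inr i)).
Qed.

Lemma closure_lin_spanP A (b : R) u v : closure (lin_span A) u ->
  closure (lin_span A) v -> closure (lin_span A) (b *: u + v).
Proof.
move=> Au Av B.
have h : (fun p : V * V => b *: p.1 + p.2) @ (u, v) --> b *: u + v.
  apply: (@cvgD _ _ _ (nbhs (u, v))); last exact: cvg_snd.
  by apply: cvgZr; exact: cvg_fst.
move=> /h [[U W] /= [Uu Wv] UWB].
have [u' [Au' Uu']] := Au _ Uu; have [v' [Av' Wv']] := Av _ Wv.
exists (b *: u' + v'); split; first exact: lin_spanP.
by apply: (UWB (u', v')).
Qed.

End span.

Section free_space.
Context {R : realType} {M : metricType R} (c : M).

Lemma eval_subproof (x : M) :
  (fun phi : lip0 M c => phi x) \in @dual_pred R (lip0 M c).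
Proof.
apply/mem_set; split; first by [].
exists (mdist x c) => phi.
by rewrite mulrC -[phi x]subr0 -(lip0_base phi); exact: lip_normP.
Qed.

Definition delta_eval (x : M) : dual (lip0 M c) := Dual (eval_subproof x).

(* F(M) is the norm closure of the span of the evaluations inside the dual of
   Lip_0(M), with the norm (hence the topology) induced by the dual norm. *)
Definition free_pred : {pred dual (lip0 M c)} :=
  mem (closure (lin_span (range delta_eval))).

Lemma free_submod : submod_closed free_pred.
Proof.
split; first by apply/mem_set; apply: subset_closure; exact: lin_span0.
by move=> a u v /set_mem Fu /set_mem Fv; apply/mem_set/closure_lin_spanP.
Qed.

HB.instance Definition _ :=
  GRing.isSubmodClosed.Build R (dual (lip0 M c)) free_pred free_submod.

Record free_space :=
  FreeSpace { free_val :> dual (lip0 M c) ; _ : free_val \in free_pred }.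

HB.instance Definition _ := [isSub for free_val].
HB.instance Definition _ := [Choice of free_space by <:].
HB.instance Definition _ := [SubChoice_isSubLmodule of free_space by <:].

Lemma free_valD m1 m2 : free_val (m1 + m2) = free_val m1 + free_val m2.
Proof. by []. Qed.

Lemma free_valZ a m : free_val (a *: m) = a *: free_val m.
Proof. by []. Qed.

Definition free_norm (m : free_space) : R := `|free_val m|.

Lemma free_normD m1 m2 : free_norm (m1 + m2) <= free_norm m1 + free_norm m2.
Proof. exact: ler_normD. Qed.

Lemma free_normZ a m : free_norm (a *: m) = `|a| * free_norm m.
Proof. exact: normrZ. Qed.

Lemma free_norm0_eq0 m : free_norm m = 0 -> m = 0.
Proof. by move/normr0_eq0 => m0; exact: val_inj. Qed.

HB.instance Definition _ := @Lmodule_isNormed.Build R free_space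
  free_norm free_normD free_normZ free_norm0_eq0.

Lemma delta_subproof (x : M) : delta_eval x \in free_pred.
Proof.
apply/mem_set; apply: subset_closure.
exists 1%N, (fun=> 1), (fun=> delta_eval x); split; first by move=> _; exists x.
by rewrite big_ord1 scale1r.
Qed.

Definition delta (x : M) : free_space := FreeSpace (delta_subproof x).

End free_space.
Arguments free_space {R} M c.

Section free_map.
Context {R : realType} {M : metricType R} {c : M}.
Variable f : M -> M.

Definition is_free_map (T : free_space M c -> free_space M c) :=
  [/\ linear T, bounded_operator T & forall x, T (delta c x) = delta c (f x)].

Lemma is_free_map_unique T1 T2 : is_free_map T1 -> is_free_map T2 -> T1 = T2.
Proof.
move=> [l1 [C1 b1] d1] [l2 [C2 b2] d2]; apply/funext => m.
have sub (T : free_space M c -> free_space M c) (l : linear T) u v :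
    T (u - v) = T u - T v.
  by rewrite [u - v]addrC -[- v]scaleN1r l scaleN1r addrC.
have lin0 (T : free_space M c -> free_space M c) (l : linear T) : T 0 = 0.
  by have := sub T l 0 0; rewrite !subrr.
have T12 n (a : 'I_n -> R) (x : 'I_n -> M) :
    T1 (\sum_i a i *: delta c (x i)) = T2 (\sum_i a i *: delta c (x i)).
  elim/big_rec : _ => [|i v _ IH]; first by rewrite !lin0.
  by rewrite l1 l2 d1 d2 IH.
apply/eqP; rewrite -subr_eq0 -normr_le0; apply/ler_addgt0Pl => e e0.
rewrite addr0.
pose K := `|C1| + `|C2| + 1.
have K0 : 0 < K by rewrite ltr_wpDl// addr_ge0.
have [m' mP] : exists m', `|m - m'| < e / K /\ T1 m' = T2 m'.
  have /set_mem Fm : free_val m \in @free_pred R M c by case: m.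
  have [_ [[n [a [w [wd ->]]]] /= mw]] :=
    Fm _ (nbhsx_ballx (free_val m) _ (divr_gt0 e0 K0)).
  have /choice[x xw] : forall i, exists x, delta_eval c x = w i.
    by move=> i; have [x _ xw] := wd i; exists x.
  exists (\sum_i a i *: delta c (x i)); split; last exact: T12.
  move: mw; rewrite -ball_normE /=.
  suff <- : free_val (\sum_i a i *: delta c (x i)) = \sum_i a i *: w i by [].
  apply: (big_ind2 (fun u v => free_val u = v)) => //.
    by move=> u1 v1 u2 v2 <- <-; exact: free_valD.
  by move=> i _; rewrite free_valZ -xw.
case: mP => mm' Tm'.
have -> : T1 m - T2 m = T1 (m - m') - T2 (m - m').
  rewrite (sub _ l1) (sub _ l2) Tm' opprB.
  by rewrite addrA subrK.
rewrite (le_trans (ler_normB _ _))// (le_trans (lerD (b1 _) (b2 _)))//.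
rewrite -mulrDl; apply: (@le_trans _ _ (K * `|m - m'|)).
  rewrite ler_wpM2r// /K -addrA lerD ?ler_norm//.
  by rewrite (le_trans (ler_norm _))// lerDl.
by rewrite mulrC -ler_pdivlMr// ltW.
Qed.

Hypothesis fL : lipschitz_map f.
Hypothesis fc : f c = c.

Let lip_k : exists2 k : R, 0 <= k & forall x y, mdist (f x) (f y) <= k * mdist x y.
Proof.
have [k fk] := fL; exists `|k| => // x y.
by rewrite (le_trans (fk x y))// ler_wpM2r ?mdist_ge0 ?ler_norm.
Qed.

Let pull_subproof (phi : lip0 M c) : (fun x => phi (f x)) \in @lip0_pred R M c.
Proof.
apply/mem_set; split; last by rewrite fc lip0_base.
have [k k0 fk] := lip_k; exists (lip_norm phi * k).
split=> [|x y]; first by rewrite mulr_ge0// lip_norm_ge0.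
by rewrite (le_trans (lip_normP _ _ _))// -mulrA ler_wpM2l ?lip_norm_ge0.
Qed.

Let pull phi : lip0 M c := Lip0 (pull_subproof phi).

Let pull_norm k : 0 <= k -> (forall x y, mdist (f x) (f y) <= k * mdist x y) ->
  forall phi, `|pull phi| <= k * `|phi|.
Proof.
move=> k0 fk phi; apply: lip_norm_le => [|x y]; first by rewrite mulr_ge0.
rewrite (le_trans (lip_normP phi (f x) (f y)))// [k * _]mulrC -mulrA.
by rewrite ler_wpM2l// lip_norm_ge0.
Qed.

Let pull_linear : linear pull.
Proof. by move=> a phi psi; exact: val_inj. Qed.

Let adj_subproof (u : dual (lip0 M c)) :
  (fun phi => u (pull phi)) \in @dual_pred R (lip0 M c).
Proof.
apply/mem_set; split.
  by move=> a phi psi; rewrite pull_linear dual_scalar.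
have [k k0 fk] := lip_k; exists (dual_norm u * k) => phi.
rewrite (le_trans (dual_normP _ _))// -mulrA ler_wpM2l ?dual_norm_ge0//.
exact: pull_norm.
Qed.

Let adj u : dual (lip0 M c) := Dual (adj_subproof u).

Let adj_linear : linear adj.
Proof. by move=> a u v; exact: val_inj. Qed.

Let adj_norm k : 0 <= k -> (forall x y, mdist (f x) (f y) <= k * mdist x y) ->
  forall u, `|adj u| <= k * `|u|.
Proof.
move=> k0 fk u; apply: dual_norm_le => [|phi]; first by rewrite mulr_ge0.
rewrite (le_trans (dual_normP u (pull phi)))// [k * _]mulrC -mulrA.
by rewrite ler_wpM2l ?dual_norm_ge0//; exact: pull_norm.
Qed.

Let adj_delta x : adj (delta_eval c x) = delta_eval c (f x).
Proof. exact: val_inj. Qed.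

Let adj_free u : u \in @free_pred R M c -> adj u \in @free_pred R M c.
Proof.
move=> /set_mem Fu; apply/mem_set => B /nbhs_ballP[e /= e0 eB].
have [k k0 fk] := lip_k.
have k1 : 0 < k + 1 by rewrite ltr_wpDl.
have [_ [[n [a [w [wd ->]]]]]] := Fu _ (nbhsx_ballx u _ (divr_gt0 e0 k1)).
set v := \sum_i _; rewrite -ball_normE /= => uv.
exists (adj v); split; last first.
  apply: eB; rewrite -ball_normE /=.
  have -> : adj u - adj v = adj (u - v).
    by rewrite [u - v]addrC -[- v]scaleN1r adj_linear scaleN1r addrC.
  rewrite (le_lt_trans (adj_norm k0 fk _))//.
  rewrite (@le_lt_trans _ _ ((k + 1) * `|u - v|)) ?ler_wpM2r ?lerDl//.
  by rewrite mulrC -ltr_pdivlMr.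
exists n, a, (fun i => adj (w i)); split.
  by move=> i; have [x _ <-] := wd i; exists (f x).
apply: (big_ind2 (fun x y => adj x = y)); first exact: val_inj.
  by move=> u1 v1 u2 v2 <- <-; exact: val_inj.
by move=> i _; exact: val_inj.
Qed.

Lemma free_map_exists : exists T, is_free_map T.
Proof.
have Fadj (m : free_space M c) : adj (free_val m) \in @free_pred R M c.
  by apply: adj_free; case: m.
exists (fun m => FreeSpace (Fadj m)); split => [a u v||x].
- exact/val_inj/adj_linear.
- by have [k k0 fk] := lip_k; exists k => m; exact: adj_norm.
- exact/val_inj/adj_delta.
Qed.

(* The linearization of [f], i.e. the only map satisfying [is_free_map f], by
   [free_mapP] and [is_free_map_unique]. *)
Definition free_map : free_space M c -> free_space M c :=
  sval (cid free_map_exists).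

Lemma free_mapP : is_free_map free_map.
Proof. exact: svalP. Qed.

End free_map.

(* Main.v *)
(* A finite combination of evaluations is perturbed in two ways. Moving each
   x_i to a nearby x_i' with f^n(x_i') close to c makes the image under the n-th
   iterate small, since delta(c) = 0. Adding b_j (delta(z_j) - delta(w_j)), with
   f^n(z_j) close to y_j, w_j close to z_j and f^n(w_j) close to c, reaches any
   target. So the linearization is mixing, with one fixed point or more, as soon
   as the iterates have dense range and, for every large n, each point has
   neighbours sent close to c by f^n.

   For an interval map the latter is proved as follows. Periodic points are
   dense: if an interval J has none, the sign of f^N - id is constant on J for
   each N > 0, while transitivity provides n with f^n > id and m with f^m < id
   on J, which clash at N = n m. Take p in J of period k, and q of period l
   close to c, between c and p. By transitivity and continuity at c, the orbit of J
   comes close to c at times of any residue modulo k l; at those divisible by k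
   the image of J contains p, hence also q. So q is in f^n(J) for all large
   multiples n of k, and continuity at c handles the other times. *)
Require Import Defs.
From mathcomp Require Import all_boot all_order all_algebra.
From mathcomp Require Import all_classical all_reals.
From mathcomp Require Import topology normedtype.
From mathcomp Require Import lra.

Set Implicit Arguments.
Unset Strict Implicit.
Unset Printing Implicit Defensive.

Import Order.TTheory GRing.Theory Num.Theory.
Import numFieldNormedType.Exports.

Local Open Scope classical_set_scope.
Local Open Scope ring_scope.

(** * Mixing implies weak mixing *)

Lemma iter_prod T (F : T -> T) n (p : T * T) :
  iter n (fun q : T * T => (F q.1, F q.2)) p = (iter n F p.1, iter n F p.2).
Proof. by elim: n => [|n /= ->]; case: p. Qed.

(** Open sets of the product contain boxes, and at the larger of the two thresholds both coordinates
    hit their targets simultaneously. *)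
Lemma mixing_weakly_mixing {X : topologicalType} (F : X -> X) :
  mixing F -> weakly_mixing F.
Proof.
move=> Fmix U V oU oV [u Uu] [v Vv].
have [[U1 U2] /= [+ +] U12] : nbhs u U by exact: open_nbhs_nbhs.
rewrite !nbhsE => -[A1 [oA1 A1u] A1U] [A2 [oA2 A2u] A2U].
have [[V1 V2] /= [+ +] V12] : nbhs v V by exact: open_nbhs_nbhs.
rewrite !nbhsE => -[B1 [oB1 B1v] B1V] [B2 [oB2 B2v] B2V].
have [|| N1 N1P] := Fmix A1 B1 oA1 oB1; [by exists u.1|by exists v.1|].
have [|| N2 N2P] := Fmix A2 B2 oA2 oB2; [by exists u.2|by exists v.2|].
have [_ [[x1 A1x <-] B1x]] := N1P _ (leq_maxl N1 N2).
have [_ [[x2 A2x <-] B2x]] := N2P _ (leq_maxr N1 N2).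
exists (maxn N1 N2), (iter (maxn N1 N2) F x1, iter (maxn N1 N2) F x2).
split; last by apply: V12; split; [exact: B1V|exact: B2V].
exists (x1, x2); last by rewrite iter_prod.
by apply: U12; split; [exact: A1U|exact: A2U].
Qed.

(** * Perturbation of finite combinations of evaluations *)

Section free_space_dynamics.
Context {R : realType} {M : metricType R} (c : M).

Lemma delta_dist x y : `|delta c x - delta c y| <= mdist x y.
Proof.
apply: dual_norm_le => [|phi]; first exact: mdist_ge0.
by rewrite mulrC; exact: lip_normP.
Qed.

Lemma delta_base : delta c c = 0.
Proof. by do 2! apply/val_inj; apply/funext => phi; exact: lip0_base. Qed.

Definition delta_comb p (a : 'I_p -> R) (x : 'I_p -> M) : free_space M c :=
  \sum_i a i *: delta c (x i).

Lemma delta_comb_base p (a : 'I_p -> R) : delta_comb a (fun=> c) = 0.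
Proof. by rewrite /delta_comb big1// => i _; rewrite delta_base scaler0. Qed.

(** As [delta c] is 1-Lipschitz, the error is at most [d] times the sum of the absolute values of
    the coefficients; the 1 added in [S] keeps it positive. *)
Lemma delta_comb_near p (a : 'I_p -> R) (e : R) : 0 < e ->
  exists2 d : R, 0 < d & forall x y : 'I_p -> M,
    (forall i, mdist (x i) (y i) < d) -> `|delta_comb a x - delta_comb a y| < e.
Proof.
move=> e0; pose S := \sum_i `|a i| + 1.
have S0 : 0 < S by rewrite ltr_wpDl// sumr_ge0.
exists (e / S) => [|x y xyd]; first exact: divr_gt0.
apply: (@le_lt_trans _ _ ((\sum_i `|a i|) * (e / S))); last first.
  by rewrite mulrCA gtr_pMr// ltr_pdivrMr// mul1r ltrDl.
rewrite /delta_comb -sumrB (le_trans (ler_norm_sum _ _ _))//.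
rewrite mulr_suml ler_sum// => i _; rewrite -scalerBr normrZ ler_wpM2l//.
exact: le_trans (delta_dist _ _) (ltW (xyd i)).
Qed.

Lemma delta_comb_dense (u : free_space M c) (e : R) : 0 < e ->
  exists p (a : 'I_p -> R) x, `|u - delta_comb a x| < e.
Proof.
move=> e0.
have /set_mem Fu : free_val u \in @free_pred R M c by case: u.
have [_ [[p [a [w [wd ->]]]] /= uw]] := Fu _ (nbhsx_ballx (free_val u) _ e0).
have /choice[x xw] : forall i, exists x, delta_eval c x = w i.
  by move=> i; have [x _ xw] := wd i; exists x.
exists p, a, x; move: uw; rewrite -ball_normE /=.
suff <- : free_val (delta_comb a x) = \sum_i a i *: w i by [].
apply: (big_ind2 (fun u v => free_val u = v)) => //.
  by move=> u1 v1 u2 v2 <- <-; exact: free_valD.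
by move=> i _; rewrite free_valZ -xw.
Qed.

Context (f : M -> M) (fL : lipschitz_map f) (fc : f c = c).

Let T := free_map fL fc.

Lemma iter_free_mapP n a u v :
  iter n T (a *: u + v) = a *: iter n T u + iter n T v.
Proof.
have [Tl _ _] := free_mapP fL fc.
by elim: n => //= n ->; rewrite {1}/T Tl.
Qed.

Lemma iter_free_mapD n u v : iter n T (u + v) = iter n T u + iter n T v.
Proof. by rewrite -[u]scale1r iter_free_mapP !scale1r. Qed.

Lemma iter_free_map0 n : iter n T 0 = 0.
Proof. by apply: (addrI (iter n T 0)); rewrite -iter_free_mapD !addr0. Qed.

Lemma iter_free_mapB n u v : iter n T (u - v) = iter n T u - iter n T v.
Proof. by rewrite addrC -scaleN1r iter_free_mapP scaleN1r addrC. Qed.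

Lemma iter_free_map_delta n x : iter n T (delta c x) = delta c (iter n f x).
Proof. by have [_ _ Td] := free_mapP fL fc; elim: n => //= n ->; exact: Td. Qed.

Lemma iter_free_map_comb n p (a : 'I_p -> R) x :
  iter n T (delta_comb a x) = delta_comb a (fun i => iter n f (x i)).
Proof.
apply: (big_ind2 (fun u v => iter n T u = v)).
- exact: iter_free_map0.
- by move=> u1 v1 u2 v2 <- <-; exact: iter_free_mapD.
- move=> i _; rewrite -[a i *: _]addr0 iter_free_mapP iter_free_map0 addr0.
  by rewrite iter_free_map_delta.
Qed.

Context (to_base : forall e : R, 0 < e -> exists N, forall n, (N <= n)%N ->
  forall x, exists x', mdist x x' < e /\ mdist c (iter n f x') < e).
Context (dense_range : forall n y (e : R), 0 < e ->
  exists x, mdist y (iter n f x) < e).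

Lemma delta_comb_to0 p (a : 'I_p -> R) x (e : R) : 0 < e ->
  exists N, forall n, (N <= n)%N ->
    exists2 u, `|delta_comb a x - u| < e & `|iter n T u| < e.
Proof.
move=> e0; have [d d0 dP] := delta_comb_near a e0.
have [N NP] := to_base d0; exists N => n Nn.
have /choice[x' xx'] i := NP n Nn (x i).
exists (delta_comb a x'); first by apply: dP => i; case: (xx' i).
rewrite -normrN -sub0r -(delta_comb_base a) iter_free_map_comb.
by apply: dP => i; case: (xx' i).
Qed.

Lemma delta_comb_from0 p (a : 'I_p -> R) y (e : R) : 0 < e ->
  exists N, forall n, (N <= n)%N ->
    exists2 u, `|u| < e & `|delta_comb a y - iter n T u| < e.
Proof.
(* One half pays for [iter n f (z i)] missing [y i], the other for [iter n f (w i)] missing [c]. *)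
move=> e0; have e20 : 0 < e / 2 by rewrite divr_gt0.
have [d d0 dP] := delta_comb_near a e20.
have [N NP] := to_base d0; exists N => n Nn.
have /choice[z yz] i := dense_range n (y i) d0.
have /choice[w zw] i := NP n Nn (z i).
exists (delta_comb a z - delta_comb a w).
  apply: (@lt_trans _ _ (e / 2)); last by rewrite gtr_pMr// invf_lt1// ltr1n.
  by apply: dP => i; case: (zw i).
rewrite iter_free_mapB !iter_free_map_comb opprB addrC -addrA addrC.
rewrite [X in _ < X]splitr (le_lt_trans (ler_normD _ _))// ltrD//.
  by rewrite addrC; exact: dP.
rewrite -normrN -sub0r -(delta_comb_base a).
by apply: dP => i; case: (zw i).
Qed.

Lemma free_map_mixing : mixing T.
Proof.
move=> U V oU oV [u Uu] [v Vv].
have [e1 /= e10 e1U] : nbhs_ball u U by apply/nbhs_ballP; exact: open_nbhs_nbhs.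
have [e2 /= e20 e2V] : nbhs_ball v V by apply/nbhs_ballP; exact: open_nbhs_nbhs.
(* Three errors add up: approximation by a combination, its perturbation, and the small other
   summand. *)
pose e := Num.min e1 e2 / 3.
have e0 : 0 < e by rewrite divr_gt0// lt_min e10.
have near3 (x y z t : free_space M c) :
    `|x - y| < e -> `|y - z| < e -> `|t| < e -> `|x - (z + t)| < Num.min e1 e2.
  move=> xy yz te; rewrite -[x](subrK y) -addrA opprD [y + _]addrA.
  rewrite (le_lt_trans (ler_normD _ _))//.
  have := ler_normB (y - z) t; rewrite /e in xy yz te *; lra.
have [p [a [x ux]]] := delta_comb_dense u e0.
have [q [b [y vy]]] := delta_comb_dense v e0.
have [N1 N1P] := delta_comb_to0 a x e0.
have [N2 N2P] := delta_comb_from0 b y e0.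
exists (maxn N1 N2) => n; rewrite geq_max.
move=> /andP[/N1P[u' xu' u'e] /N2P[w we yw]].
exists (iter n T (u' + w)); split.
  exists (u' + w) => //; apply: e1U; rewrite -ball_normE /=.
  by have := near3 _ _ _ _ ux xu' we; rewrite lt_min => /andP[].
rewrite iter_free_mapD addrC; apply: e2V; rewrite -ball_normE /=.
by have := near3 _ _ _ _ vy yw u'e; rewrite lt_min => /andP[].
Qed.

End free_space_dynamics.

(** * Iterates and sign changes of real maps *)

Lemma iter_continuous {T : topologicalType} (F : T -> T) n :
  continuous F -> continuous (iter n F).
Proof.
move=> Fc; elim: n => [|n IH] x /=; first exact: cvg_id.
exact: (continuous_comp (IH x) (Fc _)).
Qed.

Lemma iter_periodic T (F : T -> T) k m x :
  iter k F x = x -> (k %| m)%N -> iter m F x = x.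
Proof. by move=> kx /dvdnP[j ->]; rewrite iterM; exact: iter_fix. Qed.

Lemma ivt_hull {R : realType} (G : R -> R) x y v : continuous G ->
  Num.min (G x) (G y) <= v <= Num.max (G x) (G y) ->
  exists2 z, Num.min x y <= z <= Num.max x y & G z = v.
Proof.
move=> Gc; wlog xy : x y / x <= y => [hw|vxy].
  case/orP: (le_total x y) => [/hw//|/hw yx vxy].
  by rewrite minC maxC; apply: yx; rewrite minC maxC.
have [|z + <-] := IVT xy _ vxy; first exact/continuous_subspaceT.
by rewrite in_itv /= => xzy; exists z => //; rewrite (min_l xy) (max_r xy).
Qed.

Lemma hull_sub {R : realType} (u v x y z : R) : u < x < v -> u < y < v ->
  Num.min x y <= z <= Num.max x y -> u < z < v.
Proof. by case: (leP x y) => _; lra. Qed.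

(** A sign change of [G - id] between [x] and [y] would give a fixed point there, by the
    intermediate value theorem. *)
Lemma fixfree_lt {R : realType} (G : R -> R) u v x y : continuous G ->
  (forall z, u < z < v -> G z <> z) ->
  u < x < v -> u < y < v -> x < G x -> y < G y.
Proof.
move=> Gc nofix xuv yuv xGx; rewrite ltNge; apply/negP => yGy.
have hc : continuous (G - id).
  by move=> z; apply: continuousB; [exact: Gc|exact: cvg_id].
have [|z zxy] := @ivt_hull _ _ x y 0 hc.
  rewrite !fctE; case: (leP (G x - id x) (G y - id y)); rewrite /=; lra.
by rewrite !fctE => Gz; apply: (nofix z) (hull_sub xuv yuv zxy) _; lra.
Qed.

Lemma fixfree_gt {R : realType} (G : R -> R) u v x y : continuous G ->
  (forall z, u < z < v -> G z <> z) ->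
  u < x < v -> u < y < v -> G x < x -> G y < y.
Proof.
move=> Gc nofix xuv yuv Gxx; rewrite ltNge le_eqVlt.
apply/negP => /orP[/eqP e|].
  by apply: (nofix y).
by move=> /(fixfree_lt Gc nofix yuv xuv); lra.
Qed.

(** * Periodic points of a transitive interval map *)

Section transitive_interval_map.
Context {R : realType} (a b : R) (F : R -> R).
Context (ab : a < b) (Fc : continuous F).
Context (Fab : forall x : R, a <= x <= b -> a <= F x <= b).
Context (Ftrans : forall x y e : R, a <= x <= b -> a <= y <= b -> 0 < e ->
  exists n x', [/\ a <= x' <= b, `|x - x'| < e & `|y - iter n F x'| < e]).

Lemma iter_stable n x : a <= x <= b -> a <= iter n F x <= b.
Proof. by elim: n => //= n IH /IH; exact: Fab. Qed.

Lemma orbit_visits (u v y e : R) :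
  a <= u -> u < v -> v <= b -> a <= y <= b -> 0 < e ->
  exists n x, u < x < v /\ `|y - iter n F x| < e.
Proof.
move=> au uv vb yab e0.
have [||n [x [xab]]] := @Ftrans ((u + v) / 2) y (Num.min e ((v - u) / 2)) _ yab.
- lra.
- by rewrite lt_min; lra.
rewrite !lt_min => /andP[_ ux] /andP[yx _]; exists n, x; split=> //.
by move: ux; rewrite ltr_norml; lra.
Qed.

Lemma periodic_dense (u v : R) : a <= u -> u < v -> v <= b ->
  exists (p : R) k, [/\ u < p < v, (0 < k)%N & iter k F p = p].
Proof.
move=> au uv vb; apply: contrapT => noper.
have nofix k : (0 < k)%N -> forall z, u < z < v -> iter k F z <> z.
  by move=> k0 z zuv kz; apply: noper; exists z, k.
pose w := (u + v) / 2.
have itc k := @iter_continuous R F k Fc.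
(* Going from the left half to the right half gives an iterate above the diagonal; the reverse trip
   gives one below it. *)
have [n [x [xuw xw]]] : exists n x, u < x < w /\ w < iter n F x < v.
  have [|||||n [x [xuw d]]] := @orbit_visits u w ((w + v) / 2) ((v - w) / 2);
    rewrite /w; [lra..|].
  by exists n, x; split => //; move: d; rewrite ltr_norml /w; lra.
have [m [y [ywv yw]]] : exists m y, w < y < v /\ u < iter m F y < w.
  have [|||||m [y [ywv d]]] := @orbit_visits w v ((u + w) / 2) ((w - u) / 2);
    rewrite /w; [lra..|].
  by exists m, y; split => //; move: d; rewrite ltr_norml /w; lra.
have wuv : u < w < v by rewrite /w; lra.
have n0 : (0 < n)%N by case: n xw => //=; lra.
have m0 : (0 < m)%N by case: m yw => //=; lra.
have xuv : u < x < v by lra.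
have yuv : u < y < v by lra.
(* The sign at [x] of the iterate of order [k.+1 * n] also holds at [iter n F x], so one more block
   of [n] steps moves further right. *)
have up k : x < iter (k.+1 * n) F x.
  elim: k => [|k IH]; first by rewrite mul1n; lra.
  have kn : (0 < k.+1 * n)%N by rewrite muln_gt0.
  rewrite mulSn addnC iterD.
  have xn : u < iter n F x < v by lra.
  by have := fixfree_lt (itc _) (nofix _ kn) xuv xn IH; lra.
have down k : iter (k.+1 * m) F y < y.
  elim: k => [|k IH]; first by rewrite mul1n; lra.
  have km : (0 < k.+1 * m)%N by rewrite muln_gt0.
  rewrite mulSn addnC iterD.
  have ym : u < iter m F y < v by lra.
  by have := fixfree_gt (itc _) (nofix _ km) yuv ym IH; lra.
have nm0 : (0 < m * n)%N by rewrite muln_gt0 m0.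
(* Both chains reach the iterate of order [m * n], with opposite signs; the predecessors appear
   because [up] and [down] count from one block. *)
have := up m.-1; rewrite prednK//.
move=> /(fixfree_lt (itc _) (nofix _ nm0) xuv yuv).
by have := down n.-1; rewrite prednK// mulnC; lra.
Qed.

Lemma iter_dense_range n (y e : R) : a <= y <= b -> 0 < e ->
  exists2 x, a <= x <= b & `|y - iter n F x| < e.
Proof.
move=> yab e0.
have [|||p [k [puv k0 kp]]] :=
    @periodic_dense (Num.max a (y - e)) (Num.min b (y + e)).
- by rewrite le_max lexx.
- by rewrite lt_min !gt_max ab; do !(apply/andP; split); lra.
- by rewrite ge_min lexx.
move: puv; rewrite gt_max lt_min => puv.
(* The orbit of [p] is back at [p] after [n * k] steps, so this point of it is a preimage of [p]
   under the [n]-th iterate. *)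
exists (iter (n * k - n) F p); first by apply: iter_stable; lra.
rewrite -iterD subnKC ?leq_pmulr// (iter_periodic kp) ?dvdn_mull//.
by rewrite ltr_norml; lra.
Qed.

(** * Visits to the neighbourhood of a fixed point *)

Section fixed_point.
Context (c : R) (cab : a <= c <= b) (cF : F c = c).

Lemma iter_near_fix k (e : R) : 0 < e -> exists2 d : R, 0 < d &
  forall r x, (r < k)%N -> `|c - x| < d -> `|c - iter r F x| < e.
Proof.
move=> e0; elim: k => [|k [d d0 IH]]; first by exists 1.
have := @iter_continuous R F k Fc c; rewrite /continuous_at iter_fix//.
move=> /cvgrPdist_lt/(_ _ e0)/nbhs_ballP[d' /= d'0 dd'].
exists (Num.min d d'); first by rewrite lt_min d0.
move=> r x; rewrite ltnS leq_eqVlt lt_min => /orP[/eqP->|rk] /andP[xd xd'].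
  exact: dd'.
exact: IH.
Qed.

(** A visit close enough to [c] stays within [e] for [L] consecutive times, which cover all
    residues; [i] is the delay that gives residue [s]. *)
Lemma orbit_visits_fix_mod L s (u v e : R) :
  (0 < L)%N -> a <= u -> u < v -> v <= b -> 0 < e ->
  exists m x, [/\ m = s %[mod L], u < x < v & `|c - iter m F x| < e].
Proof.
move=> L0 au uv vb e0; have [d d0 dP] := iter_near_fix L e0.
have [n [x [xuv xd]]] := orbit_visits au uv vb cab d0.
pose i := ((s + (L - n %% L)) %% L)%N.
exists (i + n)%N, x; split => //; last first.
  by rewrite iterD; apply: dP => //; rewrite ltn_mod.
rewrite /i modnDml -modnDmr -addnA subnK ?modnDr//.
by rewrite ltnW// ltn_mod.
Qed.

(** Choose [q] strictly between [p] and [c]; points closer to [c] than [q] is lie beyond [q] as seen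
    from [p]. *)
Lemma periodic_near_fix (p e : R) : a <= p <= b -> p <> c -> 0 < e ->
  exists (q : R) l (d : R), [/\ (0 < l)%N, iter l F q = q, 0 < d, `|c - q| < e &
   forall y, `|c - y| < d -> Num.min p y <= q <= Num.max p y].
Proof.
move=> pab pc e0; have [cp|pc'|/esym//] := ltgtP c p; last first.
- have [|||q [l [quv l0 lq]]] := @periodic_dense (Num.max p (c - e)) c.
  + by rewrite le_max; case/andP: pab => ->.
  + by rewrite gt_max pc'; lra.
  + by case/andP: cab.
  move: quv; rewrite gt_max => quv.
  exists q, l, (c - q); split => //; [lra|by rewrite ltr_norml; lra|].
  by move=> y; rewrite ltr_norml; case: (leP p y); lra.
- have [|||q [l [quv l0 lq]]] := @periodic_dense c (Num.min p (c + e)).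
  + by case/andP: cab.
  + by rewrite lt_min cp; lra.
  + by rewrite ge_min; case/andP: pab => _ ->.
  move: quv; rewrite lt_min => quv.
  exists q, l, (q - c); split => //; [lra|by rewrite ltr_norml; lra|].
  by move=> y; rewrite ltr_norml; case: (leP p y); lra.
Qed.

Lemma eventually_near_fix (u v e : R) : a <= u -> u < v -> v <= b -> 0 < e ->
  exists N, forall n, (N <= n)%N ->
    exists2 x, u < x < v & `|c - iter n F x| < e.
Proof.
move=> au uv vb e0; have [p [k [puv k0 kp]]] := periodic_dense au uv vb.
have [pc|pc] := eqVneq p c.
  by exists 0%N => n _; exists p => //; rewrite pc iter_fix// subrr normr0.
have [d d0 dP] := iter_near_fix k e0.
have [|q [l [d' [l0 lq d'0 qd qP]]]] := periodic_near_fix _ (elimN eqP pc) d0.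
  by lra.
pose L := (k * l)%N; have L0 : (0 < L)%N by rewrite muln_gt0 k0.
(* When [k] divides [s], the [m]-th iterate fixes [p] and sends [x] past [q], so some [z] between
   them lands on [q]. Divisibility stands under the existential so that [choice] gives a time for
   every residue. *)
have hit (s : 'I_L) : exists m, (k %| s)%N ->
    m = s %[mod L] /\ exists2 z, u < z < v & iter m F z = q.
  have [m [x [ms xuv xd']]] := orbit_visits_fix_mod s L0 au uv vb d'0.
  exists m => ks; split=> //.
  have kL : (k %| L)%N by rewrite dvdn_mulr.
  have km : (k %| m)%N.
    by move: ks; rewrite /dvdn -(modn_dvdm s kL) -(modn_dvdm m kL) ms.
  have [|z zpx zq] := @ivt_hull _ (iter m F) p x q (@iter_continuous R F m Fc).
    by rewrite (iter_periodic kp)//; exact: qP.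
  by exists z => //; exact: hull_sub zpx.
have /choice[m mP] := hit.
(* The sum dominates every [m s]; the extra [k] absorbs rounding [n] down to the multiple [n1] of
   [k]. *)
exists (\sum_s m s + k)%N => n Nn.
pose n1 := (n - n %% k)%N.
have n1E : n = (n %% k + n1)%N by rewrite subnKC ?leq_mod.
have kn1 : (k %| n1)%N by rewrite /n1 {1}(divn_eq n k) addnK dvdn_mull.
pose s := Ordinal (ltn_pmod n1 L0).
have [|ms [z zuv zq]] := mP s.
  by rewrite /= /dvdn modn_dvdm// dvdn_mulr.
have msn1 : (m s <= n1)%N.
  have : (m s <= \sum_s m s)%N by rewrite (bigD1 s)//= leq_addr.
  rewrite leq_subRL ?leq_mod// => ms_sum; apply: leq_trans Nn.
  by rewrite addnC leq_add// ltnW// ltn_pmod.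
(* After [m s] steps [z] is at [q], and it is there again at time [n1] since [l] divides [n1 - m s];
   the fewer than [k] steps left stay near [c]. *)
exists z => //; rewrite n1E iterD; apply: dP; first exact: ltn_pmod.
rewrite -(subnK msn1) iterD zq (iter_periodic lq)//.
have : (L %| n1 - m s)%N.
  by rewrite -eqn_mod_dvd// ms /= modn_mod.
by apply: dvdn_trans; rewrite dvdn_mull.
Qed.

End fixed_point.
End transitive_interval_map.

(** * Transfer between the subspace and the real line *)

Section closed_interval.
Context {R : realType} (a b : R) (ab : a < b).
Local Notation M := `[a, b]%classic.

Lemma itv_valP (x : M) : a <= \val x <= b.
Proof. by have := set_valP x; rewrite /= in_itv. Qed.

Lemma mdist_itvE (x y : M) : mdist x y = `|\val x - \val y|.
Proof. by []. Qed.

Definition clip (t : R) : R := Num.max a (Num.min b t).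

Lemma clip_itv t : clip t \in M.
Proof.
apply/mem_set; rewrite /= in_itv /= /clip le_max lexx ge_max ge_min lexx.
by rewrite (ltW ab).
Qed.

Lemma clip_id t : a <= t <= b -> clip t = t.
Proof. by case/andP => at_ tb; rewrite /clip (min_r tb) (max_r at_). Qed.

Lemma clip_lipschitz s t : `|clip s - clip t| <= `|s - t|.
Proof.
have st := ler_norm (s - t); have ts := ler_norm (t - s).
rewrite distrC in ts; rewrite ler_norml /clip.
by case: (leP b s) => ?; case: (leP b t) => ?; case: (leP a b) => ?;
  case: (leP a s) => ?; case: (leP a t) => ?; lra.
Qed.

Definition retract (t : R) : M := exist _ (clip t) (clip_itv t).

Lemma retract_val (x : M) : retract (\val x) = x.
Proof. by apply/val_inj; rewrite /= clip_id// itv_valP. Qed.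

Lemma val_retract t : a <= t <= b -> \val (retract t) = t.
Proof. exact: clip_id. Qed.

Context (f : M -> M) (fL : lipschitz_map f) (ft : topologically_transitive f).

(** Extends [f] to the whole line, constant on each side of the interval, so that the results on
    continuous real maps apply. *)
Let F (t : R) : R := \val (f (retract t)).

Let iterF n x : iter n F (\val x) = \val (iter n f x).
Proof. by elim: n => //= n ->; rewrite /F retract_val. Qed.

Let Fc : continuous F.
Proof.
have [k fk] := fL; move=> x; apply/cvgrPdist_lt => e e0.
have k0 : 0 < `|k| + 1 by rewrite ltr_wpDl.
apply/nbhs_ballP; exists (e / (`|k| + 1)) => /= [|y]; first exact: divr_gt0.
rewrite /= ltr_pdivlMr// mulrC => xy.
apply: le_lt_trans xy; apply: le_trans (fk _ _) _.
rewrite (le_trans (ler_wpM2r (mdist_ge0 _ _) (ler_norm k)))//.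
by rewrite ler_pM ?mdist_ge0 ?lerDl//; exact: clip_lipschitz.
Qed.

Let Fab x : a <= x <= b -> a <= F x <= b.
Proof. by move=> _; exact: itv_valP. Qed.

Let Ftrans (x y e : R) : a <= x <= b -> a <= y <= b -> 0 < e ->
  exists n x', [/\ a <= x' <= b, `|x - x'| < e & `|y - iter n F x'| < e].
Proof.
move=> xab yab e0.
have op (z : M) : open_nbhs z (ball z e)^°.
  by split; [exact: open_interior|exact: nbhsx_ballx].
have [opx zx] := op (retract x); have [opy zy] := op (retract y).
have [||n [_ [[x' /interior_subset xx' <-] /interior_subset yx']]] :=
  ft opx opy; [by eexists; exact: zx|by eexists; exact: zy|].
exists n, (\val x'); split; first exact: itv_valP.
  by move: xx'; rewrite ballEmdist /= mdist_itvE val_retract.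
by rewrite iterF; move: yx'; rewrite ballEmdist /= mdist_itvE val_retract.
Qed.

Lemma transitive_itv_dense_range n y (e : R) : 0 < e ->
  exists x, mdist y (iter n f x) < e.
Proof.
move=> e0.
have [x xab xe] := iter_dense_range ab Fc Fab Ftrans n (itv_valP y) e0.
by exists (retract x); rewrite mdist_itvE -iterF val_retract.
Qed.

Lemma transitive_itv_near_fix c (e : R) : f c = c -> 0 < e ->
  exists N, forall n, (N <= n)%N ->
    forall x, exists x', mdist x x' < e /\ mdist c (iter n f x') < e.
Proof.
move=> fc e0; have {fc}cF : F (\val c) = \val c by rewrite /F retract_val fc.
(* The threshold found below depends on the window around [x]; compactness makes it uniform. *)
have /compact_near_coveringP cov := @segment_compact R a b.
pose P n x := exists2 x' : M, `|x - \val x'| < e & mdist c (iter n f x') < e.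
have [x /=|N _ NP] := cov _ \oo P _; last first.
  exists N => n Nn x.
  have [|x' xx' cx'] := NP n Nn (\val x); last by exists x'.
  by rewrite /= in_itv /= itv_valP.
rewrite in_itv /= => xab.
(* With radius [e / 2], a single [z] in the window is within [e] of every [y] in the ball. *)
pose u := Num.max a (x - e / 2); pose v := Num.min b (x + e / 2).
have uv : u < v by rewrite lt_min !gt_max ab; do !(apply/andP; split); lra.
have au : a <= u by rewrite le_max lexx.
have vb : v <= b by rewrite ge_min lexx.
have [N NP] := eventually_near_fix Fc Ftrans (itv_valP c) cF au uv vb e0.
exists (ball x (e / 2), [set n | (N <= n)%N]).
  split; last by exists N.
  by apply: nbhsx_ballx; rewrite divr_gt0.
move=> [y n] [/= xy /NP[z]]; rewrite gt_max lt_min => zuv zc.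
have zab : a <= z <= b by lra.
exists (retract z); last by rewrite mdist_itvE -iterF val_retract.
rewrite val_retract//; move: xy; rewrite -ball_normE /= !ltr_norml; lra.
Qed.

End closed_interval.

Theorem theorem4p1 (R : realType) (a b : R) (ab : a < b)
    (f : `[a, b]%classic -> `[a, b]%classic) (c : `[a, b]%classic)
    (fL : lipschitz_map f) (ft : topologically_transitive f) (fc : f c = c) :
  weakly_mixing (free_map fL fc) /\
  ((exists x y : `[a, b]%classic, [/\ x <> y, f x = x & f y = y]) ->
   mixing (free_map fL fc)).
Proof.
have mix : mixing (free_map fL fc).
  apply: free_map_mixing => [e e0|n y e e0].
    exact: (transitive_itv_near_fix ab fL ft fc e0).
  exact: (transitive_itv_dense_range ab fL ft n y e0).
by split=> //; exact: mixing_weakly_mixing.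
Qed.
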